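(* Consider a payment graph $H=(V,E_H)$ with a maximum circulation graph $C^*$. Let $\nu(C^* )$ denote the total demand (sum of edge weights) in $C^*$. Then, on a network $G=(V,E)$ in which each payment channel has at least $\nu(C^* )$ units of escrowed funds (i.e. $c_{u,v}\ge \nu(C^* )$ for all $(u,v)\in E$), there exists a balanced routing scheme that can achieve a total throughput of $\nu(C^* )$. However, no balanced routing scheme can achieve a throughput greater than $\nu(C^* )$ on any network $G=(V,E)$.
   Context: Network: a payment channel network is a graph $G=(V,E)$, where $V$ is the set of nodes (users/routers) and $E$ is the set of bidirectional payment channels between them; each channel $(u,v)\in E$ has a total amount $c_{u,v}$ of escrowed funds. $\mathcal{P}_{i,j}$ denotes the set of all paths from $i$ to $j$ in $G$, and $\mathcal{P}$ the set of all paths. Payment graph: a weighted directed graph $H=(V,E_H)$ specifying the payment demands between different users; the weight $d_{i,j}$ of an edge $(i,j)$ is the average rate at which user $i$ seeks to transfer funds to user $j$ (with $d_{i,j}=0$ if $(i,j)\notin E_H$). Circulation graph of $H$: any subgraph $C=(V,E_C)$ of the payment graph, with its own edge weights, in which the weight of each edge $(i,j)$ is at most the weight of $(i,j)$ in $H$, and such that for each node the total weight of incoming edges equals the total weight of outgoing edges. A maximum circulation graph of $H$ is a circulation graph with the highest total demand (sum of edge weights) among all circulation graphs of $H$; it is not necessarily unique. Routing (fluid model): a routing scheme assigns to each path $p\in\mathcal{P}$ a rate $x_p\ge 0$, the long-term average rate at which payments are sent along $p$ from its source to its destination. For a channel $(u,v)\in E$, $x_{u,v}$ denotes the total flow going from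 $u$ to $v$ across the channel, i.e. the sum of $x_p$ over paths $p$ traversing it in the direction from $u$ to $v$. The rates are subject to the demand constraints $\sum_{p\in\mathcal{P}_{i,j}}x_p\le d_{i,j}$ for all $i,j\in V$, and the capacity constraints $x_{u,v}+x_{v,u}\le c_{u,v}/\Delta$ for all $(u,v)\in E$, where $\Delta$ is the average time taken for a payment to be completed (during which the funds it uses are locked). The scheme is balanced if, in addition, $x_{u,v}=x_{v,u}$ for all $(u,v)\in E$. Its (total) throughput is the total rate of payments routed, $\sum_{p\in\mathcal{P}}x_p$.
   Formalization: For the existence half, it is added that every pair of users with positive demand is joined by a path in G, and that either Δ ≤ 1 or every channel has c_{u,v}/Δ ≥ ν(C* ); without these the claim fails (no channels; or one channel with c=ν=2, Δ=2). *)

(* Defs.v *)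
From HB Require Import structures.
From mathcomp Require Import all_boot all_order all_algebra.

Set Implicit Arguments.
Unset Strict Implicit.
Unset Printing Implicit Defensive.

Import Order.TTheory GRing.Theory Num.Theory.
Local Open Scope ring_scope.

(* A payment graph is given by its weights: its edges are the pairs (i, j)
   with d i j != 0. Demands are between different users, so there are no
   self-loops. *)
Definition payment_graph (R : realFieldType) (V : finType) (d : V -> V -> R) :=
  (forall i j, 0 <= d i j) /\ (forall i, d i i = 0).

Definition total_demand (R : realFieldType) (V : finType) (w : V -> V -> R) : R :=
  \sum_i \sum_j w i j.

(* Since 0 <= w <= d, the edges of w are edges of d. *)
Definition circulation (R : realFieldType) (V : finType) (d w : V -> V -> R) :=
  (forall i j, 0 <= w i j <= d i j) /\
  (forall i, \sum_j w j i = \sum_j w i j).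

Definition maximum_circulation (R : realFieldType) (V : finType)
    (d w : V -> V -> R) :=
  circulation d w /\
  (forall w', circulation d w' -> total_demand w' <= total_demand w).

(* [channel] is the adjacency relation of an undirected simple graph; the
   values of [escrow] outside [channel] are irrelevant. *)
Record network (R : realFieldType) (V : finType) := Network {
  channel : rel V;
  escrow : V -> V -> R;
  channel_sym : symmetric channel;
  channel_irr : irreflexive channel;
  escrow_sym : forall u v, escrow u v = escrow v u;
  escrow_ge0 : forall u v, channel u v -> 0 <= escrow u v
}.

(* Paths are vertex sequences without repetition, hence of size at most #|V|:
   bounded sequences make them range over a finite type. *)
Definition paths (R : realFieldType) (V : finType) (G : network R V) :
    {set #|V|.-bseq V} :=
  [set p : #|V|.-bseq V |
    if val p is s :: q then path (channel G) s q && uniq (s :: q) else false].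

Definition paths_between (R : realFieldType) (V : finType) (G : network R V)
    (i j : V) : {set #|V|.-bseq V} :=
  [set p in paths G |
    if val p is s :: q then (s == i) && (last s q == j) else false].

(* The rate of p is only meaningful when p \in paths G. *)
Definition rates (R : realFieldType) (V : finType) := #|V|.-bseq V -> R.

Definition flow (R : realFieldType) (V : finType) (G : network R V)
    (x : rates R V) (u v : V) : R :=
  \sum_(p in paths G | infix [:: u; v] (val p)) x p.

Definition throughput (R : realFieldType) (V : finType) (G : network R V)
    (x : rates R V) : R :=
  \sum_(p in paths G) x p.

Definition routing (R : realFieldType) (V : finType) (d : V -> V -> R)
    (G : network R V) (Delta : R) (x : rates R V) :=
  [/\ forall p, p \in paths G -> 0 <= x p,
      forall i j, \sum_(p in paths_between G i j) x p <= d i j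
    & forall u v, channel G u v ->
        flow G x u v + flow G x v u <= escrow G u v / Delta].

Definition balanced_routing (R : realFieldType) (V : finType) (d : V -> V -> R)
    (G : network R V) (Delta : R) (x : rates R V) :=
  routing d G Delta x /\
  (forall u v, channel G u v -> flow G x u v = flow G x v u).

(* Main.v *)
(* For every potential f on the nodes, telescoping f along each path gives
     \sum_(i, j) w i j * (f i - f j) = \sum_(a, b) flow a b * (f a - f b),
   where w i j is the total rate of the paths from i to j.  Taking for f the
   indicator of a node, a symmetric flow makes w a circulation, which bounds
   the throughput.  Conversely, route a circulation w along simple paths of a
   spanning forest t of the network: for an edge (u, v) of t, take for f the
   indicator of the component of u in t minus (u, v).  No other edge of t
   leaves this component, so the right-hand side is flow u v - flow v u, and the
   left-hand side vanishes because w is a circulation. *)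
Require Import Defs.
From HB Require Import structures.
From mathcomp Require Import all_boot all_order all_algebra.

Set Implicit Arguments.
Unset Strict Implicit.
Unset Printing Implicit Defensive.

Import Order.TTheory GRing.Theory Num.Theory.
Local Open Scope ring_scope.

(** * Spanning forests and simple paths *)

Definition delete_edge (V : finType) (e : rel V) (u v : V) : rel V :=
  [rel a b | [&& e a b, (a, b) != (u, v) & (a, b) != (v, u)]].

Lemma delete_edge_sym (V : finType) (e : rel V) (u v : V) :
  symmetric e -> symmetric (delete_edge e u v).
Proof.
move=> e_sym a b; rewrite /delete_edge /= e_sym !xpair_eqE.
by rewrite [(b == u) && _]andbC [(b == v) && _]andbC [X in _ && X]andbC.
Qed.

(** By induction on the number of edges: an edge whose ends stay connected without it is deleted.
    When no such edge is left every edge is a bridge, which is the form of acyclicity needed for the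
    cut argument. *)
Lemma spanning_forest (V : finType) (e : rel V) :
    symmetric e ->
  exists t : rel V,
    [/\ subrel t e, symmetric t, subrel (connect e) (connect t)
      & forall u v, t u v -> ~~ connect (delete_edge t u v) u v].
Proof.
have [n] := ubnP #|[set p | e p.1 p.2]|.
elim: n e => // n IHn e lt_e_n e_sym.
have [/existsP[[u v] /andP[/= euv cuv]] | no_cycle] :=
  boolP [exists p, e p.1 p.2 && connect (delete_edge e p.1 p.2) p.1 p.2];
  last first.
  exists e; split=> // u v euv; apply: contra no_cycle => cuv.
  by apply/existsP; exists (u, v); rewrite euv.
have d_sym := delete_edge_sym u v e_sym.
have lt_d_n : (#|[set p | delete_edge e u v p.1 p.2]| < n)%N.
  rewrite -ltnS (leq_trans _ lt_e_n) // ltnS.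
  apply/proper_card/properP; split.
    by apply/subsetP=> p; rewrite !inE => /and3P[].
  by exists (u, v); rewrite !inE /delete_edge /= ?eqxx ?andbF.
have [t [sub_td t_sym conn_t bridge]] := IHn _ lt_d_n d_sym.
exists t; split=> //; first by move=> a b /sub_td/and3P[].
(* Connectivity survives the deletion: [cuv] gives a detour around the edge between [u] and [v], in
   either direction. *)
move=> a b cab; apply: conn_t; move: a b cab; apply: connect_sub => a b eab.
have [[-> ->] // | ne_uv] := eqVneq (a, b) (u, v).
have [[-> ->] | ne_vu] := eqVneq (a, b) (v, u).
  by rewrite sym_connect_sym.
by apply: connect1; rewrite /delete_edge /= eab ne_uv.
Qed.

Lemma simple_path (V : finType) (e : rel V) (i j : V) :
  connect e i j ->
  exists p : #|V|.-bseq V, exists q,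
    [/\ val p = i :: q, path e i q, uniq (i :: q) & last i q = j].
Proof.
case/connectP=> q /shortenP[q' path_q' uniq_q' _] ->.
have size_q' : (size (i :: q') <= #|V|)%N.
  by rewrite -(card_uniqP uniq_q') max_card.
by exists (Bseq size_q'), q'.
Qed.

(** Shows that a simple path cannot cross a channel both ways, as each end would have a larger index
    than the other. *)
Lemma infix2_index (V : eqType) (u v : V) (s : seq V) :
  uniq s -> infix [:: u; v] s -> index v s = (index u s).+1.
Proof.
move=> + /infixP[s1 [s2 s_eq]]; rewrite s_eq !cat_uniq => /and3P[_ dis /andP[+ _]].
move: dis; rewrite /= inE !negb_or => /and3P[u1 v1 _] /andP[/negPf uv _].
by rewrite !index_cat (negPf u1) (negPf v1) /= !eqxx uv !addnS.
Qed.

Lemma infix2_rel (V : eqType) (e : rel V) (u v s : V) (q : seq V) :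
  path e s q -> infix [:: u; v] (s :: q) -> e u v.
Proof.
elim: q s => [|t q IHq] s /=; first by rewrite andbF.
case/andP=> est path_q /orP[/and3P[/eqP-> /eqP-> _] //|].
exact: IHq.
Qed.

(** Without repetition each step of the path occurs only once, so testing for an infix counts it
    with the right multiplicity. *)
Lemma telescope_path (R : pzRingType) (V : finType) (f : V -> R) (s : V)
    (q : seq V) :
  uniq (s :: q) ->
  f s - f (last s q) =
    \sum_a \sum_b (if infix [:: a; b] (s :: q) then f a - f b else 0).
Proof.
elim: q s => [|t q IHq] s.
  move=> _; rewrite subrr big1 // => a _; rewrite big1 // => b _.
  by rewrite /= andbF.
move=> uniq_stq; have /andP[s_tq uniq_tq] := uniq_stq.
have infixE a b : infix [:: a; b] (s :: t :: q) =
    ((a, b) == (s, t)) || infix [:: a; b] (t :: q).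
  by rewrite [LHS]/= prefix0s andbT.
have not_infix : infix [:: s; t] (t :: q) = false.
  apply: contraNF s_tq => /infixP[s1 [s2 ->]].
  by rewrite mem_cat inE eqxx orbT.
have last_t : last s (t :: q) = last t q by [].
(* The two double sums differ only at [(s, t)]: this pair is the new first step, and by [not_infix]
   it does not recur in [t :: q]. *)
rewrite -[LHS](subrKA (f t)) last_t (IHq t uniq_tq) !pair_bigA.
rewrite (bigD1 (s, t)) // [RHS](bigD1 (s, t)) // not_infix infixE eqxx Monoid.mul1m.
by congr (_ + _); apply: eq_bigr => -[a b] ne; rewrite infixE (negPf ne).
Qed.

(** * Path rates, channel flows and potentials *)

Section Rates.

Variables (R : realFieldType) (V : finType) (G : network R V).
Implicit Types (x : rates R V) (p : #|V|.-bseq V).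

Lemma pathsP p :
  reflect (exists s q, [/\ val p = s :: q, path (channel G) s q & uniq (s :: q)])
          (p \in paths G).
Proof.
rewrite inE; case: (val p) => [|s q]; first by constructor=> -[? [? []]].
apply: (iffP andP) => [[path_q uniq_q] | [s' [q' [[-> ->] path_q uniq_q]]] //].
by exists s, q.
Qed.

Lemma paths_betweenP i j p :
  reflect (exists q, [/\ val p = i :: q, path (channel G) i q, uniq (i :: q)
                       & last i q = j])
          (p \in paths_between G i j).
Proof.
rewrite inE; apply: (iffP andP) => [[/pathsP[s [q [-> path_q uniq_q]]]] | ].
  by case/andP=> /eqP<- /eqP<-; exists q.
case=> q [p_eq path_q uniq_q <-]; rewrite p_eq !eqxx; split=> //.
by apply/pathsP; exists i, q.
Qed.

(** A path determines its two ends, so after exchanging the sums exactly one pair [(i, j)]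
    contributes for each path. *)
Lemma sum_paths_between x (g : V -> V -> R) :
  \sum_i \sum_j g i j * \sum_(p in paths_between G i j) x p =
  \sum_(p in paths G) x p * (if val p is s :: q then g s (last s q) else 0).
Proof.
rewrite pair_bigA; under eq_bigr do rewrite mulr_sumr big_mkcond.
rewrite exchange_big [RHS]big_mkcond; apply: eq_bigr => p _.
case: pathsP => [[s [q [p_eq path_q uniq_q]]] | not_path]; last first.
  rewrite big1 // => -[i j] _; case: paths_betweenP => // -[q [? ? ? _]].
  by case: not_path; exists i, q.
rewrite (bigD1 (s, last s q)) // big1 => [|[i j] ne_ij].
  case: paths_betweenP => [_ | []]; last by exists q.
  by rewrite Monoid.mulm1 p_eq mulrC.
case: paths_betweenP => // -[q' [p_eq' _ _ last_q']].
move: p_eq' ne_ij; rewrite p_eq => -[-> ->].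
by rewrite last_q' eqxx.
Qed.

Lemma throughputE x :
  throughput G x = \sum_i \sum_j \sum_(p in paths_between G i j) x p.
Proof.
have := sum_paths_between x (fun _ _ => 1).
under eq_bigr do under eq_bigr do rewrite mul1r.
by move->; apply: eq_bigr => p /pathsP[s [q [-> _ _]]]; rewrite mulr1.
Qed.

Lemma sum_potential x (f : V -> R) :
  \sum_i \sum_j (f i - f j) * \sum_(p in paths_between G i j) x p =
  \sum_a \sum_b flow G x a b * (f a - f b).
Proof.
rewrite (sum_paths_between x (fun i j => f i - f j)).
rewrite [RHS]pair_bigA; under [RHS]eq_bigr do rewrite mulr_suml big_mkcondr.
rewrite [RHS]exchange_big; apply: eq_bigr => p /pathsP[s [q [p_eq _ uniq_q]]].
rewrite p_eq telescope_path // pair_bigA mulr_sumr; apply: eq_bigr => -[a b] _.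
by case: ifP; rewrite ?mulr0.
Qed.

Lemma flow_nonchannel x u v : ~~ channel G u v -> flow G x u v = 0.
Proof.
move=> /negP nuv; rewrite /flow big_pred0 // => p; apply/negP.
by case/andP=> /pathsP[s [q [-> path_q _]]] /(infix2_rel path_q).
Qed.

(** A simple path crosses the channel in at most one direction, hence its rate is counted at most
    once on the left. *)
Lemma flow_le_throughput x u v :
  (forall p, p \in paths G -> 0 <= x p) ->
  flow G x u v + flow G x v u <= throughput G x.
Proof.
move=> x_ge0; rewrite /flow !big_mkcondr -big_split; apply: ler_sum => p pG.
have xp_ge0 := x_ge0 p pG; have /pathsP[s [q [-> _ uniq_q]]] := pG.
case: ifP => [/(infix2_index uniq_q) uv | _]; last first.
  by case: ifP => _; rewrite Monoid.mul1m.
case: ifP => [/(infix2_index uniq_q) vu | _]; last by rewrite Monoid.mulm1.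
by move: (ltnn (index u (s :: q))); rewrite {2}vu uv leqW.
Qed.

End Rates.

(** * From circulations to balanced routings and back *)

Lemma circulation_potential (R : pzRingType) (V : finType) (w : V -> V -> R)
    (f : V -> R) :
  (forall i, \sum_j w j i = \sum_j w i j) ->
  \sum_i \sum_j (f i - f j) * w i j = 0.
Proof.
move=> w_circ; under eq_bigr do under eq_bigr do rewrite mulrBl.
under eq_bigr do rewrite sumrB.
(* Summation by parts: each [f i] multiplies the net outflow of [w] at [i], which is zero. *)
rewrite sumrB [X in _ - X]exchange_big; apply/eqP; rewrite subr_eq0; apply/eqP.
by apply: eq_bigr => i _; rewrite -!mulr_sumr w_circ.
Qed.

Lemma route_circulation (R : realFieldType) (V : finType) (G : network R V)
    (w : V -> V -> R) :
    (forall i j, 0 <= w i j) ->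
    (forall i, \sum_j w j i = \sum_j w i j) ->
    (forall i j, w i j != 0 -> connect (channel G) i j) ->
  exists x : rates R V,
    [/\ forall p, 0 <= x p,
        forall i j, \sum_(p in paths_between G i j) x p = w i j
      & forall u v, flow G x u v = flow G x v u].
Proof.
move=> w_ge0 w_circ w_conn.
have [t [sub_t t_sym conn_t bridge]] := spanning_forest (channel_sym G).
have ex_P (ij : V * V) : exists p : #|V|.-bseq V, w ij.1 ij.2 != 0 ->
    exists q, [/\ val p = ij.1 :: q, path t ij.1 q, uniq (ij.1 :: q)
                 & last ij.1 q = ij.2].
  have [w0 | /w_conn/conn_t/simple_path[p pP]] := eqVneq (w ij.1 ij.2) 0.
    (* The empty sequence is a default for pairs of weight zero; it will receive rate zero from
       them. *)
    by exists [bseq].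
  by exists p.
have [P PP] := fin_all_exists ex_P.
(* Each pair sends its whole weight along its chosen forest path. The sum over pairs allows several
   of them to share the default. *)
pose x p : R := \sum_ij (if p == P ij then w ij.1 ij.2 else 0).
have sum_x (A : pred (#|V|.-bseq V)) :
    \sum_(p | A p) x p = \sum_ij (if A (P ij) then w ij.1 ij.2 else 0).
  rewrite exchange_big; apply: eq_bigr => ij _; rewrite -big_mkcondr.
  case: ifP => [AP | /negP nAP].
    by rewrite (big_pred1 (P ij)) // => p /=; case: eqP => [->|_]; rewrite ?AP ?andbF.
  by rewrite big_pred0 // => p; apply: contra_notF nAP => /andP[Ap /eqP<-].
have x_between i j : \sum_(p in paths_between G i j) x p = w i j.
  rewrite sum_x (bigD1 (i, j)) // big1 => [|[k l] ne_kl].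
    rewrite Monoid.mulm1; case: ifP => // /negP nbetw; apply/esym/eqP.
    apply: contra_notT nbetw => /(PP (i, j))[q [p_eq path_q uniq_q last_q]].
    by apply/paths_betweenP; exists q; split; rewrite // (sub_path sub_t).
  (* Another pair whose chosen path joins [i] to [j] must have weight zero, since otherwise its path
     would have its own ends. *)
  case: ifP => // /paths_betweenP[q [p_eq _ _ last_q]].
  apply/eqP; apply: contraNT ne_kl => /(PP (k, l))[q' []].
  by rewrite p_eq /= => -[<- <-] _ _; rewrite last_q => <-.
have flow_off_t a b : ~~ t a b -> flow G x a b = 0.
  move=> nt_ab; rewrite /flow sum_x big1 // => ij _.
  case: ifP => // /andP[_ inf_ab]; apply/eqP; apply: contraNT nt_ab.
  by case/(PP ij)=> q [p_eq path_q _ _]; apply: infix2_rel path_q _; rewrite -p_eq.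
exists x; split=> // [p | u v].
  by apply: sumr_ge0 => ij _; case: ifP.
have [tuv | ntuv] := boolP (t u v); last by rewrite !flow_off_t // t_sym.
have cut_v := bridge u v tuv.
have d_sym := delete_edge_sym u v t_sym.
pose S a := connect (delete_edge t u v) u a; pose f a : R := (S a)%:R.
have Su : S u by apply: connect0.
have nSv : S v = false by apply: negbTE.
have S_cut a b : t a b -> (a, b) != (u, v) -> (a, b) != (v, u) -> S a = S b.
  move=> tab ne_uv ne_vu; apply/same_connect_r/connect1.
    exact: sym_connect_sym.
  by rewrite /delete_edge /= tab ne_uv.
have uv : u != v by apply: contraTneq Su => ->; rewrite nSv.
have := sum_potential G x f.
under eq_bigr do under eq_bigr do rewrite x_between.
rewrite circulation_potential // pair_bigA (bigD1 (u, v)) // (bigD1 (v, u)) /=; last first.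
  by rewrite xpair_eqE eq_sym (negPf uv).
(* Apart from the two orientations of the edge, a pair either is off the forest and carries no flow,
   or lies on one side of the cut. *)
rewrite big1 => [|[a b] /andP[ne_uv ne_vu]]; last first.
  have [tab | /flow_off_t->] := boolP (t a b); last by rewrite mul0r.
  by rewrite /f (S_cut a b) //= subrr mulr0.
rewrite /f Su nSv subr0 sub0r mulrN mulr1 mulr1 addr0 => /esym/eqP.
by rewrite subr_eq0 => /eqP.
Qed.

Lemma balanced_circulation (R : realFieldType) (V : finType) (d : V -> V -> R)
    (G : network R V) (Delta : R) (x : rates R V) :
  balanced_routing d G Delta x ->
  circulation d (fun i j => \sum_(p in paths_between G i j) x p).
Proof.
case=> -[x_ge0 x_dem _] x_bal; split=> [i j | k].
  rewrite x_dem andbT; apply: sumr_ge0 => p.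
  by rewrite inE => /andP[pG _]; apply: x_ge0.
(* Balance is assumed on channels only; elsewhere both flows vanish. *)
have flowC u v : flow G x u v = flow G x v u.
  have [/x_bal // | nuv] := boolP (channel G u v).
  by rewrite !flow_nonchannel // channel_sym.
pose f i : R := (i == k)%:R.
have sum_f (F : V -> R) : \sum_i f i * F i = F k.
  rewrite (bigD1 k) // big1 => [|i /negPf ne_ik]; last by rewrite /f ne_ik mul0r.
  by rewrite Monoid.mulm1 /f eqxx mul1r.
(* By symmetry of the flow, the flow side of [sum_potential] cancels; the other side is then the
   outflow minus the inflow at [k]. *)
have flow_f : \sum_a \sum_b flow G x a b * f a = \sum_a \sum_b flow G x a b * f b.
  by rewrite exchange_big; under eq_bigr do under eq_bigr do rewrite flowC.
have := sum_potential G x f.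
under [RHS]eq_bigr do under eq_bigr do rewrite mulrBr.
under [RHS]eq_bigr do rewrite sumrB.
rewrite sumrB flow_f subrr.
under eq_bigr do under eq_bigr do rewrite mulrBl.
under eq_bigr do rewrite sumrB.
rewrite sumrB [X in _ - X]exchange_big.
under eq_bigr do rewrite -mulr_sumr.
under [X in X - _]eq_bigr do rewrite -mulr_sumr.
by rewrite !sum_f => /eqP; rewrite subr_eq0 => /eqP/esym.
Qed.

(** Capacities are escrows divided by [Delta]: the escrow bound yields the capacity bound when
    [Delta <= 1], and the other disjunct states that bound directly. Connectivity provides a path
    for every pair with demand. *)
Theorem proposition1 (R : realFieldType) (V : finType) (d Cstar : V -> V -> R)
    (hH : payment_graph d) (hC : maximum_circulation d Cstar) :
  (forall (G : network R V) (Delta : R), 0 < Delta ->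
     (forall i j, 0 < d i j -> connect (channel G) i j) ->
     (forall u v, channel G u v -> total_demand Cstar <= escrow G u v) ->
     (Delta <= 1 \/
      forall u v, channel G u v -> total_demand Cstar <= escrow G u v / Delta) ->
     exists x : rates R V,
       balanced_routing d G Delta x /\ throughput G x = total_demand Cstar) /\
  (forall (G : network R V) (Delta : R), 0 < Delta ->
     ~ exists x : rates R V,
         balanced_routing d G Delta x /\ total_demand Cstar < throughput G x).
Proof.
case: hC => -[C_bnd C_circ] C_max; split=> G Delta Delta_gt0.
  move=> conn cap cap_Delta.
  have C_ge0 i j : 0 <= Cstar i j by case/andP: (C_bnd i j).
  have C_conn i j : Cstar i j != 0 -> connect (channel G) i j.
    move=> C_ne0; apply: conn; have /andP[_] := C_bnd i j; apply: lt_le_trans.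
    by rewrite lt_def C_ne0 C_ge0.
  have [x [x_ge0 x_dem x_bal]] := route_circulation C_ge0 C_circ C_conn.
  have x_thr : throughput G x = total_demand Cstar.
    by rewrite throughputE; apply: eq_bigr => i _; apply: eq_bigr => j _.
  exists x; split=> //; split=> //; split=> // [i j | u v uv].
    by rewrite x_dem; case/andP: (C_bnd i j).
  (* In the worst case a single channel carries the whole throughput, whence the escrow of
     [total_demand Cstar]. *)
  apply: le_trans (flow_le_throughput u v _) _ => //; rewrite x_thr.
  case: cap_Delta => [Delta_le1 | -> //].
  apply: le_trans (cap u v uv) _; rewrite ler_pdivlMr //.
  by rewrite ler_piMr // escrow_ge0.
(* The rates between pairs form a circulation whose total demand is the throughput, so maximality of
   [Cstar] applies. *)
case=> x [/balanced_circulation/C_max x_le].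
by rewrite throughputE ltNge x_le.
Qed.
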